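(* Let $n\geq4$, let $D_n=\{x\in\mathbb{Z}^n:\sum_{i=1}^n x_i\equiv0\bmod 2\}$ and let $\mathcal{P}$ be the Voronoi region of $D_n$. Then $m_1(\mathbb{R}^n,\Vert\cdot\Vert_{\mathcal{P}})\leq\frac{1}{(3/4)2^n+n-1}$.
   Context: The Voronoi region of a lattice $\Lambda\subset\mathbb{R}^n$ is $\{z:\langle z-x,z-x\rangle\geq\langle z,z\rangle\ \forall x\in\Lambda\}$; it is a convex polytope symmetric about $0$. For such $\mathcal{P}$, $\Vert x\Vert_{\mathcal{P}}=\inf\{\lambda\geq0:x\in\lambda\mathcal{P}\}$. A set $A$ avoids distance $1$ if $\Vert x-y\Vert\neq1$ for all $x,y\in A$. The density of a measurable $A\subset\mathbb{R}^n$ is $\delta(A)=\limsup_{R\to\infty}\operatorname{Vol}(A\cap[-R,R]^n)/\operatorname{Vol}([-R,R]^n)$, and $m_1(\mathbb{R}^n,\Vert\cdot\Vert)$ is the supremum of $\delta(A)$ over measurable $A$ avoiding distance $1$. *)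

(* Defs.v *)
From HB Require Import structures.
From mathcomp Require Import all_boot all_order all_algebra.
From mathcomp Require Import all_classical all_reals all_analysis.
Set Implicit Arguments. Unset Strict Implicit. Unset Printing Implicit Defensive.
Import Order.TTheory GRing.Theory Num.Theory.
Local Open Scope classical_set_scope.
Local Open Scope ring_scope.

Section Defs.
Variables (R : realType) (n : nat).

Definition dotv (x y : 'rV[R]_n) : R := \sum_(i < n) x 0 i * y 0 i.

Definition Dn : set 'rV[R]_n :=
  [set x | exists z : 'rV[int]_n,
      x = map_mx (fun k : int => k%:~R) z /\ (2 %| \sum_(i < n) z 0 i)%Z].

Definition voronoi (L : set 'rV[R]_n) : set 'rV[R]_n :=
  [set z | forall x, L x -> dotv (z - x) (z - x) >= dotv z z].

Definition gauge (P : set 'rV[R]_n) (x : 'rV[R]_n) : R :=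
  inf [set l : R | 0 <= l /\ exists2 p, P p & x = l *: p].

Definition avoids_dist1 (nrm : 'rV[R]_n -> R) (A : set 'rV[R]_n) : Prop :=
  forall x y, A x -> A y -> nrm (x - y) != 1.

Definition box (a b : 'rV[R]_n) : set 'rV[R]_n :=
  [set x | forall i, a 0 i <= x 0 i <= b 0 i].
Definition boxvol (a b : 'rV[R]_n) : R := \prod_(i < n) Num.max 0 (b 0 i - a 0 i).

Definition lebesgue_outer (A : set 'rV[R]_n) : \bar R :=
  ereal_inf [set (\sum_(0 <= k <oo) (boxvol (ab.1 k) (ab.2 k))%:E)%E
            | ab in [set ab : (nat -> 'rV[R]_n) * (nat -> 'rV[R]_n)
                       | A `<=` \bigcup_k box (ab.1 k) (ab.2 k)]].

Definition lebesgue_measurable (A : set 'rV[R]_n) : Prop :=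
  forall E : set 'rV[R]_n,
    lebesgue_outer E = (lebesgue_outer (E `&` A) + lebesgue_outer (E `&` ~` A))%E.

Definition cube (r : R) : set 'rV[R]_n := box (const_mx (- r)) (const_mx r).

Definition density (A : set 'rV[R]_n) : \bar R :=
  @limf_esup R^o R^o R (fun r : R^o => (lebesgue_outer (A `&` cube r) * ((2 * r) ^+ n)^-1%:E)%E)
            (pinfty_nbhs R).
End Defs.

(* Main.v *)
Require Import Defs.
From HB Require Import structures.
From mathcomp Require Import all_boot all_order all_algebra.
From mathcomp Require Import all_classical all_reals all_analysis.
From mathcomp Require Import measurable_realfun ring lra zify.
Import Order.TTheory GRing.Theory Num.Theory.
Local Open Scope classical_set_scope.
Local Open Scope ring_scope.

(* The gauge of the Voronoi region of D_n is x |-> max_{i != j} (|x_i| + |x_j|).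
   Let H be the set of the 2^n vectors (+-1/4, ..., +-1/4) and E the set of the
   2n vectors +-e_i/2.  If A avoids distance 1, then for every site y the set
   A /\ (y + H) has at most two points, differing in one coordinate, and
   A /\ (y + E) has at most one.  Let y share one unit equally among the points
   of A /\ (y + H) if there are any, and otherwise give it to the point of
   A /\ (y + E), if there is one.  A point x of A receives at least 1/2 from each
   site of x + H, and 1 from half of these, which makes (3/4) 2^n.  As moreover
   the points of A /\ (x + H) agree off one coordinate i, each axis j != i has
   an endpoint x +- e_j/2 that is at no H-step from A and gives its unit to x;
   this makes n - 1.  Integrating this exchange over a large cube gives the
   bound. *)

Lemma exists_neq_ord (n : nat) (i : 'I_n) : (1 < n)%N -> exists j, j != i.
Proof.
move=> n1; apply: contrapT => nj; have eqi j : j = i.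
  by apply/eqP/negPn/negP => ji; apply: nj; exists j.
move: n1; rewrite -[n]card_ord ltnNge => /negP; apply.
by apply/fintype_le1P => j k; rewrite (eqi j) (eqi k).
Qed.

(** * The Voronoi region of $D_n$ in coordinates, and vectors of gauge 1 *)

Section Gauge.
Set Implicit Arguments.
Unset Strict Implicit.
Variables (R : realType) (n : nat).
Implicit Types (x y z d : 'rV[R]_n).

Lemma dotvD x y z : dotv (x + y) z = dotv x z + dotv y z.
Proof. by rewrite -big_split; apply: eq_bigr => i _; rewrite mxE mulrDl. Qed.

Lemma dotvC x y : dotv x y = dotv y x.
Proof. by apply: eq_bigr => i _; rewrite mulrC. Qed.

Lemma dotvN x y : dotv (- x) y = - dotv x y.
Proof. by rewrite -sumrN; apply: eq_bigr => i _; rewrite mxE mulNr. Qed.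

Lemma dotv_sub_ge z x :
  (dotv z z <= dotv (z - x) (z - x)) = (2 * dotv z x <= dotv x x).
Proof.
rewrite dotvD dotvN [dotv z (z - x)]dotvC [dotv x (z - x)]dotvC !dotvD !dotvN.
rewrite (dotvC x z); apply/idP/idP; lra.
Qed.

(** Each [|k i| + k i] is even. *)
Lemma even_sum_absz (k : 'I_n -> int) :
  (2 %| \sum_i k i)%Z -> ~~ odd (\sum_i `|k i|%N).
Proof.
move=> k2; rewrite -dvdn2.
have : (2 %| \sum_i ((`|k i|%N : int) + k i))%Z.
  have kk i : (2 %| (`|k i|%N : int) + k i)%Z by lia.
  by apply: rpred_sum => i _; exact: kk.
rewrite big_split /= (rpredDr _ k2).
by rewrite -(big_morph Posz PoszD (erefl _)).
Qed.

(* The bound is affine in [t], so it suffices to have it for [t = 1/2] and for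
   [t = 1]; the latter uses the parity. *)
Lemma parity_bound (t : R) (a b : nat) : 2^-1 <= t <= 1 -> ~~ odd (a + b) ->
  2 * t * a%:R + 2 * (1 - t) * b%:R <= a%:R ^+ 2 + b%:R.
Proof.
move=> /andP[t1 t2] ab.
have h1 : 2 * a%:R <= a%:R ^+ 2 + b%:R :> R.
  rewrite -natrX -natrM -natrD ler_nat; case: a ab => [|[|a]] //=; nia.
have h2 : a%:R <= a%:R ^+ 2 :> R by rewrite -natrX ler_nat; nia.
have -> : 2 * t * a%:R + 2 * (1 - t) * b%:R =
  (2 * t - 1) * (2 * a%:R) + (2 - 2 * t) * (a%:R + b%:R) :> R by ring.
have -> : a%:R ^+ 2 + b%:R =
  (2 * t - 1) * (a%:R ^+ 2 + b%:R) + (2 - 2 * t) * (a%:R ^+ 2 + b%:R) :> R.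
  by ring.
by apply: lerD; apply: ler_wpM2l; lra.
Qed.

(** If no coordinate of [z] exceeds 1/2 in absolute value, the inequality holds coordinate by
    coordinate, since [|k i|] is at most its square. If coordinate [m] does, the others are at most
    $1-|z_m|$, and [parity_bound] applies with $a=|k_m|$ and $b$ the sum of the other $|k_i|$. *)
Lemma voronoi_Dn z : (1 < n)%N -> (forall i j, i != j -> `|z 0 i| + `|z 0 j| <= 1) ->
  voronoi (@Dn R n) z.
Proof.
move=> n1 zle _ [k [-> k2]]; rewrite dotv_sub_ge.
have /even_sum_absz := k2.
have kabs i : `|(k 0 i)%:~R| = (`|k ord0 i|%N)%:R :> R.
  by rewrite -intr_norm -abszE.
have ksq i : (k 0 i)%:~R * (k 0 i)%:~R = (`|k ord0 i|%N)%:R ^+ 2 :> R.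
  by rewrite -kabs real_normK ?num_real// expr2.
have lesq i : (`|k ord0 i|%N)%:R <= (`|k ord0 i|%N)%:R ^+ 2 :> R.
  by rewrite -natrX ler_nat; nia.
have zk i : 2 * (z 0 i * (k 0 i)%:~R) <= 2 * (`|z 0 i| * (`|k ord0 i|%N)%:R).
  by rewrite ler_pM2l// -kabs -normrM ler_norm.
move=> kodd; rewrite /dotv mulr_sumr.
have [[m zm]|hz] := pselect (exists m, 2^-1 < `|z 0 m|); last first.
  apply: ler_sum => i _; rewrite !mxE ksq.
  apply: (le_trans (zk i)); apply: le_trans (lesq i).
  rewrite mulrA ler_piMl//.
  have : ~ (2^-1 < `|z 0 i|) by move=> h; apply: hz; exists i.
  by move/negP; rewrite -leNgt; lra.
have zm1 : `|z 0 m| <= 1.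
  have [j jm] := exists_neq_ord n m n1.
  by have := zle _ _ jm; have := normr_ge0 (z 0 j); lra.
have hm i : i != m -> 2 * (z 0 i * (map_mx intr k) 0 i) <=
    2 * (1 - `|z 0 m|) * (`|k ord0 i|%N)%:R.
  move=> im; rewrite mxE; apply: (le_trans (zk i)); rewrite -mulrA ler_pM2l//.
  by apply: ler_wpM2r => //; have := zle _ _ im; lra.
rewrite (bigD1 m)//= [leRHS](bigD1 m)//=.
move: kodd; rewrite (bigD1 m)//= => kodd.
have := @parity_bound `|z 0 m| _ _ _ kodd; rewrite (ltW zm) zm1 => /(_ isT).
rewrite !mxE ksq => pb.
apply: (le_trans (lerD (zk m) (ler_sum _ hm))).
rewrite mulrA; apply: (le_trans _ (le_trans pb _)).
  by rewrite natr_sum mulr_sumr.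
rewrite lerD2l natr_sum; apply: ler_sum => i im.
by rewrite !mxE ksq.
Qed.

Lemma sum_Dn_gen (s t : bool) i j : i != j ->
  (@Dn R n) ((-1) ^+ s *: delta_mx 0 i + (-1) ^+ t *: delta_mx 0 j).
Proof.
move=> ij; exists ((-1) ^+ s *: delta_mx 0 i + (-1) ^+ t *: delta_mx 0 j); split.
  by apply/rowP => l; rewrite !mxE rmorphD !rmorphM !rmorph_sign !rmorph_nat.
rewrite (eq_bigr (fun l => (-1) ^+ s * (l == i)%:R + (-1) ^+ t * (l == j)%:R));
  last by move=> l _; rewrite !mxE.
rewrite big_split /= -!mulr_sumr.
have sumd k : \sum_(l < n) (l == k)%:R = 1 :> int.
  by rewrite (bigD1 k)//= eqxx big1 ?addr0// => l /negPf ->.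
by rewrite !sumd; case: s t => [] [].
Qed.

Lemma dotv_delta z i : dotv z (delta_mx 0 i) = z 0 i.
Proof.
rewrite /dotv (bigD1 i)//= mxE !eqxx mulr1 big1 ?addr0// => l /negPf li.
by rewrite mxE li mulr0.
Qed.

(** Test [z] against the lattice vector $\pm e_i\pm e_j$ with the signs of $z_i$ and $z_j$; its
    squared length is 2. *)
Lemma voronoi_Dn_le z i j : voronoi (@Dn R n) z -> i != j ->
  `|z 0 i| + `|z 0 j| <= 1.
Proof.
move=> zV ij; have := zV _ (sum_Dn_gen (z 0 i < 0) (z 0 j < 0) ij).
have dotvZ (c : R) x y : dotv (c *: x) y = c * dotv x y.
  by rewrite /dotv mulr_sumr; apply: eq_bigr => l _; rewrite mxE mulrA.
rewrite dotv_sub_ge dotvC !dotvD !dotvZ ![dotv (delta_mx _ _) _]dotvC.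
rewrite !dotv_delta !mxE !eqxx /= [j == i]eq_sym (negPf ij) /=.
rewrite -!normrEsign.
by case: (_ < _); case: (_ < _); rewrite ?expr1 ?expr0 /=; lra.
Qed.

(** The vector [d] lies in the region, so its gauge is at most 1. Conversely, $d=lv$ with $v$ in the
    region gives $1=l(|v_p|+|v_q|)\leq l$. *)
Lemma gauge_voronoi_Dn_eq1 d p q : p != q -> `|d 0 p| + `|d 0 q| = 1 ->
  (forall i j, i != j -> `|d 0 i| + `|d 0 j| <= 1) ->
  gauge (voronoi (@Dn R n)) d = 1.
Proof.
move=> pq dpq dle.
have n1 : (1 < n)%N.
  by have := ltn_ord p; have := ltn_ord q; move: pq; rewrite -val_eqE /=; lia.
have in1 : [set l : R | 0 <= l /\
    exists2 v, voronoi (@Dn R n) v & d = l *: v] 1.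
  by split=> //; exists d; [exact: voronoi_Dn|rewrite scale1r].
apply/eqP; rewrite eq_le; apply/andP; split.
  by apply: ge_inf => //; exists 0 => l [].
apply: lb_le_inf; first by exists 1.
move=> l [l0 [v vV dE]]; rewrite -dpq dE !mxE !normrM (ger0_norm l0) -mulrDr.
by rewrite ler_piMr// voronoi_Dn_le.
Qed.

End Gauge.

(** * Discharging *)

Section Discharging.
Set Implicit Arguments.
Unset Strict Implicit.
Variables (R : realType) (n : nat).
Implicit Types (f g : {ffun 'I_n -> bool}) (p q : 'I_n * bool) (b : bool).

Definition sgb b : R := if b then 1 else -1.

Definition half f : 'rV[R]_n := \row_i (sgb (f i) / 4).

Definition axis p : 'rV[R]_n := \row_i ((i == p.1)%:R * sgb p.2 / 2).

Lemma delta_sum_le1 (a i j : 'I_n) : i != j -> (i == a)%:R + (j == a)%:R <= 1 :> R.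
Proof.
move=> ij; have [<-|_] := eqVneq i a; last by rewrite add0r lern1; case: eqP.
by rewrite eq_sym (negPf ij) addr0.
Qed.

Lemma norm_half_sub f g i : `|(half f - half g) 0 i| = (f i != g i)%:R / 2.
Proof.
rewrite !mxE /sgb; case: (f i); case: (g i) => /=.
- by rewrite subrr normr0 mul0r.
- by rewrite ger0_norm; lra.
- by rewrite ler0_norm; lra.
- by rewrite subrr normr0 mul0r.
Qed.

Lemma gauge_half_sub f g i j : i != j -> f i != g i -> f j != g j ->
  gauge (voronoi (@Dn R n)) (half f - half g) = 1.
Proof.
move=> ij fgi fgj; apply: (gauge_voronoi_Dn_eq1 ij).
  by rewrite !norm_half_sub fgi fgj /=; lra.
move=> k l _; rewrite !norm_half_sub.
by case: (_ != _); case: (_ != _) => /=; lra.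
Qed.

Lemma norm_axis_sub p q i : p.1 != q.1 ->
  `|(axis p - axis q) 0 i| = (i == p.1)%:R / 2 + (i == q.1)%:R / 2.
Proof.
case: p q => [k s] [l t] /= kl; rewrite !mxE /= /sgb.
have [->|ik] := eqVneq i k.
  rewrite (negPf kl) !mul0r subr0 mul1r addr0.
  by case: s => /=; [rewrite ger0_norm; lra|rewrite ler0_norm; lra].
rewrite !mul0r !add0r normrN; case: eqP => _; last by rewrite !mul0r normr0.
rewrite mul1r.
by case: t => /=; [rewrite ger0_norm; lra|rewrite ler0_norm; lra].
Qed.

(** Opposite endpoints of one axis differ by $\pm e_k$, endpoints of two axes by $(\pm e_k\pm
    e_l)/2$. *)
Lemma gauge_axis_sub p q : (1 < n)%N -> p != q ->
  gauge (voronoi (@Dn R n)) (axis p - axis q) = 1.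
Proof.
move=> n1 pq; have [pq1|pq1] := eqVneq p.1 q.1.
  have norm1 i : `|(axis p - axis q) 0 i| = (i == p.1)%:R.
    move: pq pq1; case: p q => [k s] [l t] /= + kl; subst l.
    rewrite xpair_eqE eqxx /= => st; rewrite !mxE /= /sgb.
    case: (i == k) => /=; last by rewrite !mul0r subrr normr0.
    rewrite !mul1r; case: s t st => [] [] //= _.
      by rewrite ger0_norm; lra.
    by rewrite ler0_norm; lra.
  have [j] := @exists_neq_ord n p.1 n1; rewrite eq_sym => jp.
  apply: (gauge_voronoi_Dn_eq1 jp).
    by rewrite !norm1 eqxx eq_sym (negPf jp) addr0.
  by move=> k l kl; rewrite !norm1 delta_sum_le1.
apply: (gauge_voronoi_Dn_eq1 pq1); rewrite ?norm_axis_sub//.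
  by rewrite !eqxx [q.1 == _]eq_sym (negPf pq1) /=; lra.
move=> k l kl; rewrite !norm_axis_sub//.
have := delta_sum_le1 p.1 kl.
have := delta_sum_le1 q.1 kl.
lra.
Qed.

(** The disagreement in sign gives the entry at [p.1] absolute value 3/4; all other entries have
    1/4. *)
Lemma gauge_axis_half p f : (1 < n)%N -> f p.1 != p.2 ->
  gauge (voronoi (@Dn R n)) (axis p - half f) = 1.
Proof.
case: p => k s /= n1 fk.
have normE i : `|(axis (k, s) - half f) 0 i| = 4^-1 + (i == k)%:R / 2.
  rewrite !mxE /= /sgb; have [->|_] := eqVneq i k.
    by case: s fk; case: (f k) => //= _; [rewrite ger0_norm; lra|rewrite ler0_norm; lra].
  by case: (f i) => /=; [rewrite ler0_norm; lra|rewrite ger0_norm; lra].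
have [j] := @exists_neq_ord n k n1; rewrite eq_sym => kj.
apply: (gauge_voronoi_Dn_eq1 kj).
  by rewrite !normE eqxx eq_sym (negPf kj) /=; lra.
move=> i l il; rewrite !normE.
have := delta_sum_le1 k il.
lra.
Qed.

(** Let members [f] and [g] differ at [i]. A member [h] that differs from [f] at some [j != i] would
    differ at both [i] and [j] from [g] if [h i = f i], and from [f] otherwise. *)
Lemma hamming_clique (P : {ffun 'I_n -> bool} -> Prop) : (0 < n)%N ->
  (forall f g i j, P f -> P g -> f i != g i -> f j != g j -> i = j) ->
  exists i, forall f g j, P f -> P g -> j != i -> f j = g j.
Proof.
move=> n0 clq.
have [[f [g [i [Pf Pg fgi]]]]|H] :=
    pselect (exists f g i, [/\ P f, P g & f i != g i]); last first.
  exists (Ordinal n0) => f g j Pf Pg _; apply/eqP/negPn/negP => fgj.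
  by apply: H; exists f, g, j.
exists i.
suff H h j : P h -> j != i -> h j = f j by move=> h h' j Ph Ph' ji; rewrite !H.
move=> Ph ji; apply/eqP/negPn/negP => hfj.
have fgj : f j = g j.
  by apply/eqP/negPn/negP => fgj; move: ji; rewrite (clq _ _ _ _ Pf Pg fgi fgj) eqxx.
have [hfi|hfi] := eqVneq (h i) (f i).
  have hgi : h i != g i by rewrite hfi.
  have hgj : h j != g j by rewrite -fgj.
  by move: ji; rewrite (clq _ _ _ _ Ph Pg hgi hgj) eqxx.
by move: ji; rewrite (clq _ _ _ _ Ph Pf hfi hfj) eqxx.
Qed.

(** * Shares given and received when [A] avoids distance 1 *)

Variable A : set 'rV[R]_n.
Hypothesis n1 : (1 < n)%N.
Hypothesis avoidA : avoids_dist1 (gauge (voronoi (@Dn R n))) A.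
Implicit Types x y : 'rV[R]_n.

Lemma half_inj_in y f g i j : A (y - half f) -> A (y - half g) ->
  f i != g i -> f j != g j -> i = j.
Proof.
move=> Af Ag fgi fgj; apply/eqP/negPn/negP => ij.
have := avoidA Ag Af.
rewrite (_ : _ - _ = half f - half g); last by rewrite opprB addrC subrKA.
by rewrite (gauge_half_sub ij)// eqxx.
Qed.

(** Written as a sum of indicators, this count is visibly measurable in [y] when [A] is
    measurable. *)
Definition nhalf y : R := \sum_f \1_A (y - half f).

Lemma nhalfE y : nhalf y = #|[set f | (y - half f)%R \in A]%SET|%:R.
Proof.
rewrite /nhalf -sum1_card natr_sum [RHS]big_mkcond /=; apply: eq_bigr => f _.
by rewrite inE indicE; case: (_ \in A).
Qed.

(** The words counted agree off one coordinate [i], so [f i] determines [f]. *)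
Lemma card_nhalf y : (#|[set f | (y - half f)%R \in A]%SET| <= 2)%N.
Proof.
have [i iP] := @hamming_clique (fun f => A (y - half f)) (ltnW n1) (@half_inj_in y).
rewrite -card_bool -(@card_in_imset _ _ (fun f : {ffun 'I_n -> bool} => f i)).
  exact: max_card.
move=> f g; rewrite !inE => Af Ag fgi.
by apply/ffunP => j; have [->|ji] := eqVneq j i; last exact: iP.
Qed.

Lemma axis_uniq x p q : A (x + axis p) -> A (x + axis q) -> p = q.
Proof.
move=> Ap Aq; apply/eqP/negPn/negP => pq; have := avoidA Ap Aq.
rewrite (_ : _ - _ = axis p - axis q); last by rewrite opprD addrACA subrr add0r.
by rewrite (gauge_axis_sub n1 pq) eqxx.
Qed.

Lemma axisN p : axis (p.1, ~~ p.2) = - axis p.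
Proof.
by apply/rowP => i; rewrite !mxE /= /sgb; case: p.2; rewrite /= ?mulrN ?mulNr// ?opprK.
Qed.

Definition step := ({ffun 'I_n -> bool} + 'I_n * bool)%type.

Definition disp (s : step) := match s with inl f => half f | inr p => axis p end.

(* The share of the site [y] that goes to a point [y - disp s] of [A] when
   [k = nhalf y].  On the possible values 0, 1, 2 of [k] these polynomials agree
   with [1 / k] (for [k > 0]) and with the indicator of [k = 0]. *)
Definition share (s : step) (k : R) : R :=
  match s with inl _ => (3 - k) / 2 | inr _ => (1 - k) * (2 - k) / 2 end.

Lemma share_ge0 s y : 0 <= share s (nhalf y).
Proof.
rewrite nhalfE; have := card_nhalf y; case: #|_| => [|[|[|//]]] _;
  by case: s => ? /=; lra.
Qed.

(** With [k = nhalf y], the half steps receive $k(3-k)/2$ in all, which is 0 for $k=0$ and 1 for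
    $k=1,2$. The axis steps receive at most $(1-k)(2-k)/2$, which is 1 for $k=0$ and 0 for
    $k=1,2$. *)
Lemma sum_share_le1 y : \sum_s \1_A (y - disp s) * share s (nhalf y) <= 1.
Proof.
rewrite big_sumType /= -!mulr_suml -/(nhalf y).
have axis1 : \sum_p \1_A (y - axis p) <= 1 :> R.
  have [[p Ap]|nA] := pselect (exists p, A (y - axis p)).
    rewrite (bigD1 p)//= big1 ?addr0; last first.
      move=> q qp; rewrite indicE memNset// => Aq; move/eqP: qp; apply.
      have := @axis_uniq y (q.1, ~~ q.2) (p.1, ~~ p.2).
      rewrite !axisN => /(_ Aq Ap) [q1 q2].
      by move: q1 q2; case: (q) (p) => [? ?] [? ?] /= -> /negb_inj ->.
    by rewrite indicE; case: (_ \in _).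
  rewrite big1// => p _; rewrite indicE memNset// => Ap.
  by apply: nA; exists p.
have axis0 : 0 <= \sum_p \1_A (y - axis p) :> R by apply: sumr_ge0.
rewrite nhalfE; have := card_nhalf y; case: #|_| => [|[|[|//]]] _; lra.
Qed.

(** Flipping all signs exchanges the words with [f i = b] and the others. *)
Lemma sum_half_coord i b : \sum_(f : {ffun 'I_n -> bool}) (f i == b)%:R = 2 ^+ n / 2 :> R.
Proof.
pose neg f : {ffun 'I_n -> bool} := [ffun j => ~~ f j].
have negK : involutive neg by move=> f; apply/ffunP => j; rewrite !ffunE negbK.
have flip : \sum_(f : {ffun 'I_n -> bool}) (f i == b)%:R =
    \sum_(f : {ffun 'I_n -> bool}) (f i != b)%:R :> R.
  rewrite (reindex_inj (inv_inj negK)); apply: eq_bigr => f _.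
  by rewrite ffunE; case: (f i); case: b.
have : \sum_(f : {ffun 'I_n -> bool}) ((f i == b)%:R + (f i != b)%:R) = 2 ^+ n :> R.
  rewrite (eq_bigr (fun=> 1)); last by move=> f _; case: eqP => _ /=; lra.
  by rewrite sumr_const card_ffun card_bool card_ord natrX.
by rewrite big_split /= -flip; lra.
Qed.

Lemma half_sub_edge f g i : f i != g i -> (forall j, j != i -> f j = g j) ->
  half f - half g = axis (i, f i).
Proof.
move=> fgi fgj; apply/rowP => j; rewrite !mxE /=.
have [->|ji] := eqVneq j i; last by rewrite fgj// subrr !mul0r.
by move: fgi; rewrite /sgb; case: (f i); case: (g i) => //= _; lra.
Qed.

Lemma share_half_ge x : A x ->
  3 / 4 * 2 ^+ n <= \sum_f share (inl f) (nhalf (x + half f)).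
Proof.
move=> Ax.
(* The only axis step that can lead from [x] into [A]; arbitrary if there is none. *)
have [p pP] : exists p, forall q, A (x + axis q) -> q = p.
  have [[p Ap]|nA] := pselect (exists p, A (x + axis p)).
    by exists p => q Aq; exact: axis_uniq Aq Ap.
  by exists (Ordinal (ltnW n1), true) => q Aq; case: nA; exists q.
apply: (@le_trans _ _ (\sum_(f : {ffun 'I_n -> bool}) (1 - (f p.1 == p.2)%:R / 2))).
  rewrite big_split /= sumrN -mulr_suml sum_half_coord sumr_const card_ffun.
  rewrite card_bool card_ord natrX; lra.
apply: ler_sum => f _ /=; rewrite nhalfE.
have := card_nhalf (x + half f).
have [fp|fp] := eqVneq (f p.1) p.2.
  by case: #|_| => [|[|[|//]]] _ /=; lra.
(* A second word [g] would differ from [f] in a single coordinate [i]. Then [x + axis (i, f i)]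
   would lie in [A], forcing [(i, f i) = p] against [fp]. *)
suff : (#|[set g | (x + half f - half g)%R \in A]%SET| <= 1)%N.
  by case: #|_| => [|[|//]] _ _ /=; lra.
rewrite -[leqRHS](cards1 f); apply/subset_leq_card/fintype.subsetP => g.
rewrite !inE => Ag.
apply/eqP/ffunP => i; apply/eqP/negPn/negP => gfi.
have Af : A (x + half f - half f) by rewrite addrK.
have : A (x + axis (i, f i)).
  rewrite -(half_sub_edge (g := g)) ?addrA//; first by rewrite eq_sym.
  move=> j ji; apply/eqP/negPn/negP; rewrite eq_sym => gfj.
  by move: ji; rewrite (half_inj_in Ag Af gfj gfi) eqxx.
by move/pP => pE; move: fp; rewrite -pE /= eqxx.
Qed.

Lemma share_axis_ge x : A x ->
  n%:R - 1 <= \sum_p share (inr p) (nhalf (x + axis p)).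
Proof.
move=> Ax.
have [i iP] : exists i, forall f g j, A (x + half f) -> A (x + half g) ->
    j != i -> f j = g j.
  apply: (@hamming_clique (fun f => A (x + half f)) (ltnW n1)).
  move=> f g k l Af Ag fgk fgl; apply/eqP/negPn/negP => kl.
  have := avoidA Af Ag.
  rewrite (_ : _ - _ = half f - half g); last by rewrite opprD addrACA subrr add0r.
  by rewrite (gauge_half_sub kl)// eqxx.
have free j : j != i -> exists b, nhalf (x + axis (j, b)) = 0.
  move=> ji.
  (* Take [b] opposite to the common sign at [j] of the half steps from [x] into [A]. *)
  have [b bP] : exists b, forall f, A (x + half f) -> f j != b.
    have [[f Af]|nA] := pselect (exists f, A (x + half f)).
      by exists (~~ f j) => g Ag; rewrite (iP _ _ _ Ag Af ji); case: (f j).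
    by exists true => f Af; case: nA; exists f.
  exists b; rewrite /nhalf big1// => f _; rewrite indicE memNset// => Af.
  (* The supposed point [x + axis (j, b) - half f] of [A] is at distance 1 from [x] if [f j != b].
     Otherwise it is [x + half g] with [g j = b], which [bP] excludes. *)
  have [fj|fj] := eqVneq (f j) b; last first.
    have := avoidA Af Ax.
    rewrite (_ : _ - x = axis (j, b) - half f); last by rewrite addrAC [x + _]addrC addrK.
    by rewrite gauge_axis_half ?eqxx.
  pose g : {ffun 'I_n -> bool} := [ffun k => if k == j then b else ~~ f k].
  suff gE : half g = axis (j, b) - half f.
    have : g j != b by apply: bP; rewrite gE addrA.
    by rewrite ffunE !eqxx.
  apply/rowP => k; rewrite !mxE ffunE /=; case: eqP => [->|_].
    by rewrite fj /=; lra.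
  by rewrite /sgb; case: (f k) => /=; lra.
rewrite -(pair_bigA _ (fun j b => share (inr (j, b)) (nhalf (x + axis (j, b))))) /=.
rewrite (bigD1 i)//=.
apply: (@le_trans _ _ (0 + \sum_(j < n | j != i) 1)).
  by rewrite add0r sumr_const cardC1 card_ord -subn1 natrB ?(ltnW n1).
apply: lerD.
  by apply: sumr_ge0 => b _; exact: (share_ge0 (inr (i, b))).
apply: ler_sum => j /free[b jb]; rewrite (bigD1 b)//= jb.
apply: ler_wpDr; last lra.
by apply: sumr_ge0 => c _; exact: (share_ge0 (inr (j, c))).
Qed.

Lemma sum_share_ge x : A x ->
  3 / 4 * 2 ^+ n + n%:R - 1 <= \sum_s share s (nhalf (x + disp s)).
Proof.
move=> Ax; rewrite big_sumType /= -addrA.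
by apply: lerD; [exact: share_half_ge|exact: share_axis_ge].
Qed.

End Discharging.

(** * Lebesgue outer measure *)

Section LebesgueOuter.
Set Implicit Arguments.
Unset Strict Implicit.
Variables (R : realType) (n : nat).
Notation rV := 'rV[R]_n.+1.
Implicit Types (a b t x : rV) (E F : set rV) (ab : (nat -> rV) * (nat -> rV)).
Local Notation mu := (@lebesgue_outer R n.+1).

Lemma boxvol_ge0 a b : 0 <= boxvol a b.
Proof. by apply: prodr_ge0 => i _; rewrite le_max lexx. Qed.

Local Open Scope ereal_scope.

Definition coversum ab : \bar R := \sum_(0 <= k <oo) (boxvol (ab.1 k) (ab.2 k))%:E.

Lemma coversum_ge0 ab : 0 <= coversum ab.
Proof. by apply: nneseries_ge0 => k _ _; rewrite lee_fin boxvol_ge0. Qed.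

Lemma lebesgue_outer_ge0 E : 0 <= mu E.
Proof. by apply: le_ereal_inf_tmp => _ [ab _ <-]; exact: coversum_ge0. Qed.

Lemma le_lebesgue_outer : {homo mu : E F / E `<=` F >-> E <= F}.
Proof.
move=> E F EF; apply: ereal_inf_le_tmp => _ [ab Fab <-].
by exists ab => //; exact: subset_trans EF Fab.
Qed.

Lemma lebesgue_outer_le_coversum E ab :
  E `<=` \bigcup_k box (ab.1 k) (ab.2 k) -> mu E <= coversum ab.
Proof. by move=> Eab; apply: ereal_inf_lbound; exists ab. Qed.

(** Here the dimension must be positive: in dimension 0 the empty product gives every box volume 1,
    so covers could not be padded with null boxes. *)
Lemma boxvol00 : boxvol (0 : rV) 0 = 0%R.
Proof. by rewrite /boxvol big_ord_recl !mxE subrr maxxx mul0r. Qed.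

Lemma lebesgue_outer0 : mu set0 = 0.
Proof.
apply/eqP; rewrite eq_le lebesgue_outer_ge0 andbT.
apply: (@le_trans _ _ (coversum (fun=> 0%R, fun=> 0%R))).
  exact: lebesgue_outer_le_coversum.
by rewrite /coversum eseries0// => k _ _ /=; rewrite boxvol00.
Qed.

Lemma lebesgue_outer_box a b : mu (box a b) <= (boxvol a b)%:E.
Proof.
pose c (x : rV) k : rV := if k is 0%N then x else 0%R.
apply: (@le_trans _ _ (coversum (c a, c b))).
  by apply: lebesgue_outer_le_coversum => x abx; exists 0%N.
rewrite /coversum nneseries_recl//; last by move=> k _; rewrite lee_fin boxvol_ge0.
rewrite eseries0 ?adde0//; by case=> //= k _ _; rewrite boxvol00.
Qed.

Lemma lebesgue_outer_sigma_subadditive : sigma_subadditive mu.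
Proof.
move=> E; have [[i Eoo]|] := pselect (exists i, mu (E i) = +oo).
  rewrite (eseries_pinfty _ _ Eoo) ?leey// => k _.
  by rewrite -ltNye (lt_le_trans _ (lebesgue_outer_ge0 _)).
rewrite -forallNE => Eoo.
apply/lee_addgt0Pr => e e0.
rewrite (le_trans _ (epsilon_trick _ _ (ltW e0)))//; last first.
  by move=> k; exact: lebesgue_outer_ge0.
have [G GP] : {G : nat -> (nat -> rV) * (nat -> rV) & forall k,
    E k `<=` \bigcup_j box ((G k).1 j) ((G k).2 j) /\
    coversum (G k) <= mu (E k) + (e / (2 ^ k.+1)%:R)%:E}.
  apply: (@choice _ _ (fun k ab => E k `<=` \bigcup_j box (ab.1 j) (ab.2 j) /\
    coversum ab <= mu (E k) + (e / (2 ^ k.+1)%:R)%:E)) => k.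
  have muE : mu (E k) \is a fin_num.
    by rewrite ge0_fin_numE ?lebesgue_outer_ge0// ltey; apply/eqP; exact: Eoo.
  have ek : (0 < e / (2 ^ k.+1)%:R)%R by rewrite divr_gt0// ltr0n expn_gt0.
  have [_ [ab Eab <-] /ltW abl] := lb_ereal_inf_adherent ek muE.
  by exists ab.
pose v (ij : nat * nat) := (boxvol ((G ij.1).1 ij.2) ((G ij.1).2 ij.2))%:E.
have v0 ij : 0 <= v ij by rewrite lee_fin boxvol_ge0.
(* The covers [G i] are merged into one sequence along a bijection [h] from [nat] to pairs. *)
have /card_esym/ppcard_eqP[h] := card_nat2.
pose c : (nat -> rV) * (nat -> rV) :=
  (fun k => (G (h k).1).1 (h k).2, fun k => (G (h k).1).2 (h k).2).
apply: (@le_trans _ _ (coversum c)).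
  apply: lebesgue_outer_le_coversum => x [i _ Eix].
  have [j _ xij] := (GP i).1 x Eix.
  by exists (h^-1%FUN (i, j)) => //=; rewrite invK ?inE.
have -> : coversum c = \sum_(i <oo) coversum (G i).
  transitivity (\esum_(ij in [set: nat * nat]) v ij).
    rewrite /coversum nneseries_esumT; last by move=> k; rewrite lee_fin boxvol_ge0.
    by rewrite (reindex_esum setT setT h).
  pose J i : set (nat * nat) := [set (i, j) | j in setT].
  rewrite (_ : setT = \bigcup_k J k); last first.
    by rewrite predeqE => -[i j]; split => // _; exists i => //; exists j.
  rewrite esum_bigcupT//; last first.
    apply/trivIsetP => i j _ _ ij; rewrite predeqE => -[k l]; split => //=.
    by move=> [[_ _ [<- _]] [_ _ [ji _]]]; rewrite ji eqxx in ij.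
  rewrite nneseries_esumT; last by move=> k; exact: coversum_ge0.
  apply: eq_esum => i _; rewrite /coversum nneseries_esumT; last first.
    by move=> k; rewrite lee_fin boxvol_ge0.
  rewrite (reindex_esum setT (J i) (fun j => (i, j)))//.
  split; [by move=> j _; exists j|by move=> ? ? _ _ []|by move=> _ [j _ <-]; exists j].
apply: lee_nneseries => k _; first by move=> _; exact: coversum_ge0.
exact: (GP k).2.
Qed.

(** Translating covers gives one inequality for every shift; the shift by [- t] gives its
    converse. *)
Lemma lebesgue_outer_shift t E : mu ((fun x => x + t)%R @^-1` E) = mu E.
Proof.
suff le_shift s F : mu ((fun x => x + s)%R @^-1` F) <= mu F.
  apply/eqP; rewrite eq_le le_shift /=.
  rewrite (_ : mu E = mu ((fun x => x - t)%R @^-1` ((fun x => x + t)%R @^-1` E))).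
    exact: le_shift.
  by congr (mu _); apply/seteqP; split => x /=; rewrite subrK.
apply: le_ereal_inf_tmp => _ [ab Fab <-].
pose ab' : (nat -> rV) * (nat -> rV) := (fun k => ab.1 k - s, fun k => ab.2 k - s)%R.
have -> : \sum_(0 <= k <oo) (boxvol (ab.1 k) (ab.2 k))%:E = coversum ab'.
  apply: eq_eseriesr => k _; congr EFin; apply: eq_bigr => i _.
  by rewrite !mxE opprD addrACA subrr addr0.
apply: lebesgue_outer_le_coversum => x /Fab[k _ xk]; exists k => // i.
by have := xk i; rewrite !mxE lerBlDr lerBrDr.
Qed.

Lemma lebesgue_measurable_shift t E :
  lebesgue_measurable E -> lebesgue_measurable ((fun x => x + t)%R @^-1` E).
Proof.
move=> mE X; rewrite -(lebesgue_outer_shift (- t) X) [LHS]mE.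
rewrite -(lebesgue_outer_shift (- t) (X `&` _)).
rewrite -(lebesgue_outer_shift (- t) (X `&` ~` _)).
by congr (mu _ + mu _); apply/seteqP; split=> x /=; rewrite subrK.
Qed.

Lemma boxvol_split a b (i : 'I_n.+1) (c : R) :
  (boxvol a (\row_j if j == i then Num.min (b 0 j) c else b 0 j) +
   boxvol (\row_j if j == i then Num.max (a 0 j) c else a 0 j) b = boxvol a b)%R.
Proof.
rewrite /boxvol [X in (X + _)%R](bigD1 i)//= [X in (_ + X)%R](bigD1 i)//=.
rewrite [RHS](bigD1 i)//= !mxE !eqxx.
set P := (\prod_(j < n.+1 | j != i) Num.max 0 (b 0 j - a 0 j))%R.
rewrite (_ : (\prod_(j < n.+1 | j != i) _)%R = P); last first.
  by apply: eq_bigr => j /negPf ji; rewrite !mxE ji.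
rewrite (_ : (\prod_(j < n.+1 | j != i) _)%R = P); last first.
  by apply: eq_bigr => j /negPf ji; rewrite !mxE ji.
rewrite -mulrDl; congr (_ * _)%R.
rewrite /Num.min /Num.max.
by repeat case: ifP => /negP; lra.
Qed.

HB.instance Definition _ := isOuterMeasure.Build R rV mu lebesgue_outer0
  lebesgue_outer_ge0 le_lebesgue_outer lebesgue_outer_sigma_subadditive.

(** [H] is left free on the hyperplane $x_i=c$, so that open and closed half-spaces are both
    covered. Each box of a cover is cut at [c] into two closed boxes whose volumes add up
    exactly. *)
Lemma halfspace_measurable (i : 'I_n.+1) (c : R) (H : set rV) :
  (forall x, (x 0 i < c)%R -> H x) -> (forall x, H x -> (x 0 i <= c)%R) ->
  lebesgue_measurable H.
Proof.
move=> ltH Hle.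
apply: (@le_caratheodory_measurable R rV mu) => E.
apply: le_ereal_inf_tmp => _ [ab Eab <-].
pose lo k : rV := \row_j if j == i then Num.min (ab.2 k ord0 j) c else ab.2 k ord0 j.
pose hi k : rV := \row_j if j == i then Num.max (ab.1 k ord0 j) c else ab.1 k ord0 j.
rewrite (_ : \sum_(0 <= k <oo) _ = coversum (ab.1, lo) + coversum (hi, ab.2)).
  apply: leeD; apply: lebesgue_outer_le_coversum => x [/Eab[k _ xk] xH].
    exists k => // j; rewrite mxE; case: eqP => [->|_]; last exact: xk.
    by rewrite le_min Hle// andbT; have /andP[] := xk i.
  exists k => // j; rewrite mxE; case: eqP => [->|_]; last exact: xk.
  rewrite ge_max; have /andP[xa ->] := xk i; rewrite xa /=.
  by rewrite ?andbT leNgt; apply/negP => /ltH.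
rewrite -nneseriesD; [|by move=> k _ _; rewrite lee_fin boxvol_ge0..].
by apply: eq_eseriesr => k _; rewrite -EFinD boxvol_split.
Qed.

End LebesgueOuter.

(** * From shares to densities *)

Section Transport.
Set Implicit Arguments.
Unset Strict Implicit.
Local Open Scope ereal_scope.

Lemma measurable_indic_preimage d (T : measurableType d) (R : realType)
    (E : set T) (phi : T -> T) :
  (forall F, measurable F -> measurable (phi @^-1` F)) -> measurable E ->
  measurable_fun [set: T] (fun y => \1_E (phi y) : R).
Proof.
move=> mphi mE; apply: measurableT_comp; first exact: measurable_indic.
by move=> _ F mF; rewrite setTI; exact: mphi.
Qed.

(** Mass transport: integrate the lower bound [cf] over [G], replace each $\int f_i\circ\tau_i$ by
    $\int f_i$ by invariance of [mu], and bound the total by [fQ]. *)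
Lemma transport_le d (T : measurableType d) (R : realType)
    (mu : {measure set T -> \bar R}) (I : finType) (tau : I -> T -> T)
    (f : I -> T -> R) (c : R) (G Q : set T) :
  (forall i F, measurable F -> measurable (tau i @^-1` F)) ->
  (forall i F, measurable F -> mu (tau i @^-1` F) = mu F) ->
  measurable G -> measurable Q -> (0 <= c)%R ->
  (forall i, measurable_fun setT (f i)) ->
  (forall i y, 0 <= f i y)%R ->
  (forall y, \sum_i f i y <= \1_Q y)%R ->
  (forall x, G x -> c <= \sum_i f i (tau i x))%R ->
  c%:E * mu G <= mu Q.
Proof.
move=> mtau mutau mG mQ c0 mf f0 fQ cf.
have mtauF i : measurable_fun setT (tau i).
  by move=> _ F mF; rewrite setTI; exact: mtau.
have mEf i : measurable_fun setT (EFin \o f i) by exact/measurable_EFinP.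
have mEft i : measurable_fun setT (EFin \o (fun y => f i (tau i y))).
  exact: (measurableT_comp (mEf i)).
rewrite -(setIT G) -[in leLHS]integral_indic//.
have ind0 (E : set T) x : setT x -> 0 <= (\1_E x)%:E :> \bar R.
  by rewrite lee_fin.
have mind (E : set T) : measurable E ->
    measurable_fun setT (fun x => (\1_E x)%:E : \bar R).
  by move=> mE; apply: measurableT_comp => //; exact: measurable_indic.
rewrite -(ge0_integralZl_EFin mu measurableT (ind0 G) (mind G mG) c0).
apply: (@le_trans _ _ (\int[mu]_x \sum_i (f i (tau i x))%:E)).
  apply: ge0_le_integral => //.
  - by move=> x _; rewrite -EFinM lee_fin mulr_ge0.
  - by apply: emeasurable_funM => //; exact: mind.
  - exact: emeasurable_sum.
  - move=> x _; rewrite sumEFin -EFinM lee_fin indicE.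
    case: (boolP (x \in G)) => [/set_mem /cf|_]; first by rewrite mulr1.
    by rewrite mulr0 sumr_ge0.
rewrite ge0_integral_sum//; last by move=> i x _; rewrite lee_fin.
have -> : \sum_(i : I) \int[mu]_x (f i (tau i x))%:E =
          \sum_(i : I) \int[mu]_x (f i x)%:E.
  apply: eq_bigr => i _.
  rewrite [RHS](@eq_measure_integral _ _ _ setT (pushforward mu (tau i))).
    rewrite (ge0_integral_pushforward (mtauF i) mu measurableT (mEf i))//.
    by move=> y _; rewrite lee_fin.
  by move=> F mF _; rewrite /= /pushforward mutau.
rewrite -ge0_integral_sum//; last by move=> i x _; rewrite lee_fin.
rewrite -[leRHS](congr1 mu (setIT Q)) -[in leRHS]integral_indic//.
apply: ge0_le_integral => //.
- by move=> x _; rewrite sumEFin lee_fin sumr_ge0.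
- exact: emeasurable_sum.
- exact: mind.
- by move=> x _; rewrite sumEFin lee_fin.
Qed.

End Transport.

(** * The exchange over large cubes and the limit *)

Section Density.
Import numFieldNormedType.Exports.
Set Implicit Arguments.
Unset Strict Implicit.
Variables (R : realType) (n : nat).
Local Notation mu := (@lebesgue_outer R n.+1).

(* [matrix] is pointed only over a canonically pointed base type, which a
   [realType] is not; the library's Caratheodory construction needs a point. *)
Definition rvec : Type := 'rV[R]_n.+1.

HB.instance Definition _ := Choice.on rvec.
HB.instance Definition _ := isPointed.Build rvec (0 : 'rV[R]_n.+1).

Definition lebesgue_om : {outer_measure set rvec -> \bar R} := mu.

Local Notation cara := (caratheodory_type lebesgue_om).

(** Measurability in [cara] is [lebesgue_measurable] by conversion. *)
Lemma shift_measurable (t : 'rV[R]_n.+1) (E : set cara) :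
  measurable E -> measurable ((fun x => x + t) @^-1` E : set cara).
Proof. exact: (@lebesgue_measurable_shift R n t E). Qed.

Lemma cube_measurable (r : R) : measurable (cube r : set cara).
Proof.
have -> : (cube r : set cara) = \bigcap_(i in [set: 'I_n.+1])
    ([set x : 'rV[R]_n.+1 | x 0 i <= r] `&` ~` [set x : 'rV[R]_n.+1 | x 0 i < - r]).
  apply/seteqP; split => x xr i.
    move=> _ /=; have := xr i; rewrite !mxE => /andP[rx ->]; split=> //.
    by apply/negP; rewrite -leNgt.
  by have /= [xi /negP] := xr i I; rewrite !mxE xi andbT -leNgt.
apply: fin_bigcap_measurable => // i _; apply: measurableI; last apply: measurableC.
  by apply: (@halfspace_measurable R n i r) => x //=; exact: ltW.
by apply: (@halfspace_measurable R n i (- r)) => x //=; exact: ltW.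
Qed.

Lemma lebesgue_outer_cube (r : R) : 0 <= r -> (mu (cube r) <= ((2 * r) ^+ n.+1)%:E)%E.
Proof.
move=> r0; apply: le_trans (lebesgue_outer_box _ _) _; rewrite lee_fin /boxvol.
rewrite (eq_bigr (fun=> 2 * r)) ?prodr_const ?card_ord// => i _.
by rewrite !mxE max_r; lra.
Qed.

(** This crude bound enlarges the cube from [r] to [r + 1], which does not affect the limit. *)
Lemma disp_le1 (s : step n.+1) i : `|disp R s 0 i| <= 1.
Proof.
case: s => [f|p] /=; rewrite !mxE /sgb.
  by case: (f i); [rewrite ger0_norm; lra|rewrite ler0_norm; lra].
case: (i == p.1); rewrite /= ?mul0r ?normr0// mul1r.
by case: p.2; [rewrite ger0_norm; lra|rewrite ler0_norm; lra].
Qed.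

Lemma avoiding_cube_bound (A : set 'rV[R]_n.+1) (r : R) : (0 < n)%N ->
  lebesgue_measurable A -> avoids_dist1 (gauge (voronoi (@Dn R n.+1))) A ->
  0 <= r ->
  ((3 / 4 * 2 ^+ n.+1 + n.+1%:R - 1)%:E * mu (A `&` cube r) <=
   ((2 * (r + 1)) ^+ n.+1)%:E)%E.
Proof.
move=> n0 mA avoidA r0; have n1 : (1 < n.+1)%N by [].
apply: le_trans (lebesgue_outer_cube _); last by lra.
(* Only receivers are restricted to the cube; [nhalf] still sees all of [A], so each point of [A] in
   the cube keeps its full total share. *)
pose f s (y : 'rV[R]_n.+1) : R :=
  \1_(A `&` cube r) (y - disp R s) * share s (nhalf A y).
have mind (t : 'rV[R]_n.+1) (E : set cara) : measurable E ->
    measurable_fun setT (fun y : cara => \1_E (y + t : 'rV[R]_n.+1) : R).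
  move=> mE.
  apply: (@measurable_indic_preimage _ cara R E (fun y => y + t : 'rV[R]_n.+1)) => //.
  exact: shift_measurable.
have mnhalf : measurable_fun setT (nhalf A : cara -> R).
  by apply: measurable_sum => g; exact: mind.
have mG : measurable (A `&` cube r : set cara).
  by apply: measurableI => //; exact: cube_measurable.
apply: (@transport_le _ cara R lebesgue_om _
    (fun s (x : 'rV[R]_n.+1) => x + disp R s) f _
    (A `&` cube r) (cube (r + 1))) => //.
- by move=> s E; exact: shift_measurable.
- by move=> s E _; exact: lebesgue_outer_shift.
- exact: cube_measurable.
- move=> s; apply: measurable_funM; first exact: mind.
  have mB c : measurable_fun setT (fun y : cara => c - nhalf A y).
    by apply: measurable_funB.
  case: s => [g|p] /=; apply: measurable_funM => //.
  by apply: measurable_funM.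
- by move=> s y; rewrite mulr_ge0// share_ge0.
- move=> y; rewrite indicE; case: (boolP (y \in _)) => [_|/negP yr].
    apply: le_trans (sum_share_le1 n1 avoidA y); apply: ler_sum => s _.
    apply: ler_wpM2r; first exact: share_ge0.
    rewrite !indicE in_setI; case: (_ \in A) => //=.
    by case: (_ \in _).
  rewrite big1// => s _; rewrite /f indicE memNset ?mul0r// => -[_ ycr].
  apply: yr; rewrite inE => i; have := ycr i; have := disp_le1 s i.
  by rewrite !mxE ler_norml => /andP[? ?] /andP[? ?]; apply/andP; split; lra.
- move=> x [Ax xr]; apply: le_trans (sum_share_ge n1 avoidA Ax) _.
  apply: ler_sum => s _; rewrite /f addrK indicE mem_set ?mul1r//.
Qed.

(** The ratio of the volumes of the cubes of half-sides $r+1$ and $r$ is $(1+1/r)^{n+1}$, which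
    tends to 1. *)
Lemma density_le (A : set 'rV[R]_n.+1) (c : R) : 0 < c ->
  (forall r, 0 <= r ->
    (c%:E * mu (A `&` cube r) <= ((2 * (r + 1)) ^+ n.+1)%:E)%E) ->
  (density A <= (c^-1)%:E)%E.
Proof.
move=> c0 Ac; apply/lee_addgt0Pr => e e0.
have cvg1 : (1 + r^-1) ^+ n.+1 / c @[r --> +oo] --> c^-1.
  rewrite [X in _ --> X](_ : _ = (1 + 0) ^+ n.+1 / c); last first.
    by rewrite addr0 expr1n mul1r.
  have V0 : (r^-1 : R) @[r --> +oo] --> (0 : R).
    by apply/gtr0_cvgV0; [exists 0|exact: cvg_id].
  apply: cvgM; last exact: cvg_cst.
  apply: (@continuous_cvg _ _ _ _ _ _ (fun x : R => x ^+ n.+1)).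
    exact: exprn_continuous.
  by apply: cvgD => //; exact: cvg_cst.
have := cvgr_le c^-1 cvg1 (c^-1 + e); rewrite ltrDl => /(_ _ e0) near_le.
apply: ge_ereal_inf.
(* The upper limit is an infimum of suprema over neighbourhoods of infinity; the [r] at which the
   bound is within [e] of its limit contain one. *)
exists (ereal_sup [set (mu (A `&` cube r) * ((2 * r) ^+ n.+1)^-1%:E)%E
    | r in [set r | 0 < r /\ (1 + r^-1) ^+ n.+1 / c <= c^-1 + e]]).
  exists [set r | 0 < r /\ (1 + r^-1) ^+ n.+1 / c <= c^-1 + e] => //.
  by apply: filterI => //; exists 0.
apply: ge_ereal_sup => _ [r [r0 rle] <-].
apply: (@le_trans _ _ ((1 + r^-1) ^+ n.+1 / c)%:E); last by rewrite -EFinD lee_fin.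
have rn0 : 0 < (2 * r) ^+ n.+1 by rewrite exprn_gt0 ?mulr_gt0.
rewrite lee_pdivrMr// -EFinM.
rewrite (_ : _ / c * _ = c^-1 * (2 * (r + 1)) ^+ n.+1); last first.
  rewrite mulrAC -exprMn mulrC; congr (_ * _ ^+ _).
  by field; rewrite gt_eqF.
by rewrite EFinM lee_pdivlMl//; exact/Ac/ltW.
Qed.

End Density.

Theorem theorem5 (R : realType) (n : nat) : (4 <= n)%N ->
  forall A : set 'rV[R]_n,
    lebesgue_measurable A ->
    avoids_dist1 (gauge (voronoi (@Dn R n))) A ->
    (density A <= (((3 / 4) * 2 ^+ n + n%:R - 1)^-1)%:E)%E.
Proof.
case: n => [//|n] n4 A mA avoidA; apply: density_le; last first.
  by move=> r; apply: avoiding_cube_bound => //; exact: (@leq_trans 3).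
by rewrite -addrA ltr_wpDr ?subr_ge0 ?ler1n// mulr_gt0 ?exprn_gt0.
Qed.
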